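(* Let $C_n$ be the cycle graph on $n\ge3$ vertices and let $\ell\in\{1,\dots,n-1\}$. Then for every $k\in\mathbb{N}_0$ and every real number $c$ the following two identities hold: $$\frac1n\sum_{j=0}^{n-1}e^{-2\pi ij\ell/n}\left(2c\sin^2\Big(\frac{\pi j}n\Big)+1-c\right)^k=\sum_{\substack{m\in\{1,\dots,k\}\\ n\mid m\pm\ell}}(-1)^mI_m^c(k),$$ and $$\frac1n\sum_{j=0}^{n-1}\left(2c\sin^2\Big(\frac{\pi j}n\Big)+1-c\right)^k=I_0^c(k)+2\sum_{s=1}^{\lfloor k/n\rfloor}(-1)^{sn}I_{sn}^c(k).$$
   Context: The sum on the right-hand side of the first identity is over the indices $m\in\{1,\dots,k\}$ such that $n\mid m\pm\ell$, i.e. $m\equiv\ell\pmod n$ or $m\equiv-\ell\pmod n$. Discrete $I$-Bessel function: for $t,r\in\mathbb{N}_0$ with $r\le t$ and $c\in\mathbb{C}$, $$I_r^c(t)=\sum_{p=0}^{\lfloor (t-r)/2\rfloor}\frac{t!}{p!\,(t-2p-r)!\,(r+p)!}\left(\frac c2\right)^{2p+r},$$ and $I_r^c(t)=0$ for $r>t$. Conventions: $0^0=1$ and empty sums are $0$. In the exponential, $i$ is the imaginary unit.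
   Formalization: In the first identity, an m with both n | m+ℓ and n | m−ℓ (possible only when n = 2ℓ) is counted twice, once per sign; counted once the identity fails, e.g. n = 4, ℓ = 2, k = 2, c = 1 gives 1/2 on the left and 1/4 on the right. *)

(* Defs.v *)
From HB Require Import structures.
From mathcomp Require Export all_boot all_order all_algebra.
From mathcomp Require Export complex.
From mathcomp Require Export reals sequences exp trigo.

Set Implicit Arguments.
Unset Strict Implicit.
Unset Printing Implicit Defensive.

Import Order.TTheory GRing.Theory Num.Theory.

Local Open Scope ring_scope.
Local Open Scope complex_scope.

(* The complex exponential, e^(x + iy) = e^x (cos y + i sin y). *)
Definition cexp (R : realType) (z : R[i]) : R[i] :=
  let: x +i* y := z in (expR x)%:C * (cos y +i* sin y).

(* The discrete I-Bessel function I_r^c(t). Both the halving and the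
   subtractions are on nat: for r <= t, [(t - r)./2] is the floor, and
   [t - p.*2 - r] is not truncated for p in the range of summation. *)
Definition discI (R : realType) (r : nat) (c : R[i]) (t : nat) : R[i] :=
  if (r <= t)%N then
    \sum_(0 <= p < ((t - r)./2).+1)
      t`!%:R / (p`!%:R * (t - p.*2 - r)`!%:R * (r + p)`!%:R)
        * (c / 2) ^+ (p.*2 + r)
  else 0.

(* Main.v *)
Require Import Defs.
From mathcomp Require Import ring lra zify.
Import Order.TTheory GRing.Theory Num.Theory.
Local Open Scope ring_scope.
Local Open Scope complex_scope.

(** The left-hand sides are entries of the [k]-th power of a circulant matrix,
diagonalized by the [n]-th roots of unity. With [w = e^(2 pi i / n)] and
[x = w^j], the half-angle formula gives

  [2 c sin^2 (pi j / n) + 1 - c = 1 - (c / 2) (x + 1 / x)],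

the generating function of one step of a lazy walk on the integers, so its
[k]-th power is a Laurent polynomial in [x], symmetric under [x <-> 1 / x].
Its coefficient at [x^m] and [x^-m] is [(-1)^m I_m^c(k)]: the summand of the
Bessel sum is a trinomial coefficient, which factors as a product of two
binomial coefficients, and Pascal's rule turns into the recursion

  [a (k+1) m = a k m + u (a k (m-1) + a k (m+1))],  [u = - c / 2],

that multiplication by [1 + u (x + 1 / x)] imposes ([expr_walk],
[discI_walk_coef]). Averaging [x^z] times this expansion over all the [n]-th
roots of unity [x] keeps exactly the exponents divisible by [n]
([prim_root_filter]); this is [cycle_walk_sum], whose cases [z = - l] and
[z = 0] are the two identities. *)

(** * Laurent coefficients of powers of a symmetric trinomial *)

(** The coefficient of [x ^ r] in [(1 + u (x + x^-1)) ^+ k]: the [p]-th term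
collects the [k]-step paths with [p + r] steps up and [p] steps down. As the
binomial coefficient vanishes for [p > k], any [N > k] gives the same value;
keeping [N] apart from [k] lets the recursions in [k] compare sums over one
range. *)
Definition walk_coef {A : pzRingType} (u : A) (N k r : nat) : A :=
  \sum_(p < N) ('C(k, p.*2 + r) * 'C(p.*2 + r, p))%:R * u ^+ (p.*2 + r).

Lemma walk_coef_small {A : pzRingType} (u : A) (N k r : nat) :
  (k < r)%N -> walk_coef u N k r = 0.
Proof.
move=> ltkr; apply: big1 => p _.
by rewrite bin_small ?mul0n ?mul0r //; lia.
Qed.

Lemma walk_coef0n {A : pzRingType} (u : A) (N : nat) : walk_coef u N.+1 0 0 = 1.
Proof.
rewrite /walk_coef big_ord_recl big1 => [|p _]; last by rewrite bin0n mul0r.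
by rewrite !bin0 expr0 mul1r addr0.
Qed.

(** Pascal's rule at [r = 0], where the neighbours [1] and [-1] contribute
equally; the factor 2 is the symmetry of the odd rows,
['C(2p+2, p+1) = 2 'C(2p+1, p)]. *)
Lemma walk_coefS0 {A : comPzRingType} (u : A) (N k : nat) : (k < N)%N ->
  walk_coef u N k.+1 0 = walk_coef u N k 0 + u * (2 * walk_coef u N k 1).
Proof.
case: N => // N ltkN; rewrite /walk_coef big_ord_recl [in RHS]big_ord_recl /=.
rewrite !bin0 -addrA; congr (_ + _).
(* The shift [p -> p + 1] loses the last term, which vanishes as [k < N]. *)
rewrite [X in 2 * X]big_ord_recr /= bin_small ?mul0n ?mul0r ?addr0; last by lia.
rewrite 2!mulr_sumr -big_split; apply: eq_bigr => p _ /=.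
have -> : bump 0 p = p.+1 by [].
rewrite doubleS !addn0 addn1 binS.
have -> : 'C(p.*2.+2, p.+1) = (2 * 'C(p.*2.+1, p))%N.
  rewrite binS -[in X in (X + _)%N]bin_sub; last by lia.
  by rewrite (_ : (_ - _)%N = p); lia.
by rewrite mulnDl natrD mulrDl !natrM exprS; ring.
Qed.

(** Pascal's rule for the number of moving steps splits off the paths whose
last step is lazy; Pascal's rule for the number of steps down then splits the
others by direction, a last step down pairing [p + 1] with [p]. *)
Lemma walk_coefSS {A : comPzRingType} (u : A) (N k r : nat) : (k < N)%N ->
  walk_coef u N k.+1 r.+1
  = walk_coef u N k r.+1 + u * (walk_coef u N k r + walk_coef u N k r.+2).
Proof.
case: N => // N ltkN.
rewrite [walk_coef _ _ k r.+2]big_ord_recr /= bin_small ?mul0n ?mul0r ?addr0; last lia.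
rewrite /walk_coef.
rewrite big_ord_recl [X in X + u * _]big_ord_recl [X in u * (X + _)]big_ord_recl /=.
rewrite !bin0 -[X in u * X]addrA -big_split mulrDr mulr_sumr addrACA -big_split.
congr (_ + _); first by rewrite add0n binS !muln1 natrD mulrDl exprS; ring.
apply: eq_bigr => p _ /=; have -> : bump 0 p = p.+1 by [].
rewrite doubleS !addnS !addSn !binS !(mulnDl, mulnDr) !natrD !natrM !exprS.
ring.
Qed.

Lemma expr_walk {A : comPzRingType} (u x y : A) (N k : nat) :
  x * y = 1 -> (k <= N)%N ->
  (1 + u * (x + y)) ^+ k
  = walk_coef u N.+1 k 0
    + \sum_(1 <= m < k.+1) walk_coef u N.+1 k m * (x ^+ m + y ^+ m).
Proof.
move=> xy1; elim: k => [|k IHk] leN.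
  by rewrite big_nil addr0 expr0 walk_coef0n.
rewrite exprS IHk; last exact: ltnW.
rewrite walk_coefS0 ?ltnS 1?ltnW // !big_add1 !big_mkord /=.
under [in RHS]eq_bigr => m _ do rewrite walk_coefSS ?ltnS 1?ltnW //.
set d := walk_coef u N.+1 k; set z := fun m => x ^+ m + y ^+ m.
have zS m : (x + y) * z m.+1 = z m.+2 + z m.
  rewrite /z !exprS -[X in _ = _ + X]mul1r -xy1; ring.
pose S f := \sum_(m < k.+1) f m * z m.+1.
have -> : \sum_(m < k) d m.+1 * z m.+1 = S (fun m => d m.+1).
  by rewrite /S big_ord_recr /= /d walk_coef_small // mul0r addr0.
(* The boundary terms of the two shifts: [x + y] itself comes from [d 0], and
   [2 * d 1] from [(x + y) * (x + y)], since [x * y = 1]. *)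
have shift : (x + y) * (d 0 + S (fun m => d m.+1))
    = 2 * d 1 + S d + S (fun m => d m.+2).
  have up : \sum_(m < k.+1) d m.+1 * z m.+2 + d 0 * z 1 = S d.
    rewrite /S [RHS]big_ord_recl /= big_ord_recr /= [d k.+1]walk_coef_small //.
    by rewrite mul0r addr0 addrC.
  have down : \sum_(m < k.+1) d m.+1 * z m = 2 * d 1 + S (fun m => d m.+2).
    rewrite /S big_ord_recl big_ord_recr /= [d k.+2]walk_coef_small //.
    by rewrite mul0r addr0 /z !expr0 mulrC.
  rewrite -up addrAC -down mulrDr [LHS]addrC [RHS]addrA; congr (_ + _); last first.
    by rewrite /z !expr1 mulrC.
  rewrite /S mulr_sumr -big_split; apply: eq_bigr => m _ /=.
  by rewrite mulrCA zS; ring.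
have -> : \sum_(m < k.+1) (d m.+1 + u * (d m + d m.+2)) * z m.+1
    = S (fun m => d m.+1) + u * (S d + S (fun m => d m.+2)).
  rewrite /S -big_split mulr_sumr -big_split; apply: eq_bigr => m _ /=; ring.
rewrite mulrDl mul1r -mulrA shift; ring.
Qed.

(** Beyond [(k - r) / 2] the binomial form vanishes, and up to it
[k! / (p! (k - 2p - r)! (r + p)!) = 'C(k, 2p + r) 'C(2p + r, p)]. The sign
depends on [r] alone because the exponent [2p + r] has the parity of [r]. *)
Lemma discI_walk_coef (R : realType) (c : R[i]) (N k r : nat) : (k < N)%N ->
  (-1) ^+ r * discI r c k = walk_coef (- (c / 2)) N k r.
Proof.
move=> ltkN; rewrite /discI; case: leqP => [lerk|ltkr]; last first.
  by rewrite mulr0 walk_coef_small.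
rewrite /walk_coef -(big_mkord predT
  (fun p => ('C(k, p.*2 + r) * 'C(p.*2 + r, p))%:R * (- (c / 2)) ^+ (p.*2 + r))).
rewrite [RHS](@big_cat_nat _ _ _ ((k - r)./2).+1) //=; last by lia.
rewrite [X in _ = _ + X]big_nat_cond [X in _ = _ + X]big1; last first.
  by move=> p /andP[hp _]; rewrite bin_small ?mul0n ?mul0r //; lia.
rewrite addr0 mulr_sumr; apply: eq_big_nat => p hp.
have le1 : (p.*2 + r <= k)%N by lia.
have le2 : (p <= p.*2 + r)%N by lia.
have e1 := bin_fact le1; have e2 := bin_fact le2.
have nz m : (m`!%:R : R[i]) != 0 by rewrite pnatr_eq0 -lt0n fact_gt0.
have -> : (k`!%:R : R[i]) = ('C(k, p.*2 + r) * 'C(p.*2 + r, p))%:R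
    * (p`!%:R * (k - p.*2 - r)`!%:R * (r + p)`!%:R).
  rewrite -!natrM -e1 -e2.
  have -> : (p.*2 + r - p = r + p)%N by lia.
  rewrite subnDA; congr (_%:R); ring.
rewrite mulfK ?mulf_neq0 // [in RHS]exprNn.
rewrite [X in _ = _ * (X * _)]exprD -mul2n exprM sqrrN !expr1n; ring.
Qed.

(** * Roots of unity *)

Definition cis {R : realType} (a : R) : R[i] := cos a +i* sin a.

Lemma cis0 {R : realType} : cis (0 : R) = 1.
Proof. by rewrite /cis cos0 sin0. Qed.

Lemma cisD {R : realType} (a b : R) : cis (a + b) = cis a * cis b.
Proof. by rewrite /cis cosD sinD; simpc; rewrite [X in _ +i* X]addrC. Qed.

Lemma cisMn {R : realType} (a : R) (m : nat) : cis (a * m%:R) = cis a ^+ m.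
Proof.
elim: m => [|m IHm]; first by rewrite mulr0 cis0.
by rewrite -natr1 mulrDr mulr1 cisD IHm exprSr.
Qed.

Lemma cis_neq0 {R : realType} (a : R) : cis a != 0.
Proof.
have h : cis a * cis (- a) = 1 by rewrite -cisD subrr cis0.
by apply: contra_eqN h => /eqP->; rewrite mul0r eq_sym oner_eq0.
Qed.

Lemma cisN {R : realType} (a : R) : cis (- a) = (cis a)^-1.
Proof. by apply: (mulfI (cis_neq0 a)); rewrite -cisD subrr cis0 mulfV ?cis_neq0. Qed.

Lemma cis_addV {R : realType} (a : R) :
  cis (2 * a) + (cis (2 * a))^-1 = (2 * (1 - 2 * sin a ^+ 2))%:C.
Proof.
rewrite -cisN /cis cosN sinN; simpc.
by rewrite mulr_natl cos_mulr2n cos2sin2; congr (_ +i* _); ring.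
Qed.

(** If [cis (2 * a) = 1] then [sin a = 0] by the half-angle formula, which is
impossible for [a = pi i / n] with [0 < i < n]. *)
Lemma cis_prim_root {R : realType} (n : nat) : (0 < n)%N ->
  n.-primitive_root (cis (2 * (pi / n%:R)) : R[i]).
Proof.
move=> n0; have nR : (n%:R : R) != 0 by rewrite pnatr_eq0 -lt0n.
apply/andP; split=> //; apply/forallP => i; rewrite unity_rootE -cisMn.
apply/eqP; apply/eqP/eqP => [h|->]; last first.
  have -> : 2 * (pi / n%:R) * n%:R = pi + pi :> R.
    by rewrite -mulrA divfK // mulr_natl mulr2n.
  by rewrite /cis cosD sinD cospi sinpi !(mulr0, mul0r, addr0, subr0, mulrNN, mulr1).
move: h; set a : R := pi / n%:R * i.+1%:R.
have -> : 2 * (pi / n%:R) * i.+1%:R = 2 * a by rewrite /a; ring.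
move=> h; have := cis_addV a; rewrite h invr1 => /(congr1 (@complex.Re R)) /= e.
have {}e : sin a == 0 by rewrite -sqrf_eq0; apply/eqP; lra.
have := ltn_ord i; rewrite leq_eqVlt => /predU1P[//|ltin].
suff : 0 < sin a by rewrite (eqP e) ltxx.
apply: sin_gt0_pi; apply/andP; split.
  by apply: mulr_gt0; rewrite ?ltr0n // divr_gt0 ?pi_gt0 ?ltr0n.
by rewrite /a mulrAC ltr_pdivrMr ?ltr0n // (ltr_pM2l (pi_gt0 R)) ltr_nat.
Qed.

(** The geometric sum of ratio [w ^ a], an [n]-th root of unity that equals 1
exactly when [n] divides [a]. Integer exponents let one statement serve both
halves of a Laurent polynomial. *)
Lemma prim_root_filter {F : fieldType} (n : nat) (w : F) (a : int) :
  n.-primitive_root w ->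
  \sum_(0 <= j < n) (w ^+ j) ^ a = n%:R * (n%:Z %| a)%Z%:R.
Proof.
move=> prw; have n0 := prim_order_gt0 prw.
have wn := prim_expr_order prw.
rewrite big_mkord; under eq_bigr => j _.
  rewrite [w ^+ j]exprnP exprz_exp mulrC -exprz_exp -exprnP; over.
have -> : (n%:Z %| a)%Z = (w ^ a == 1).
  rewrite dvdzE absz_nat (prim_order_dvd prw).
  by case: a => m //=; rewrite NegzE -exprnN invr_eq1.
case: eqP => [->|/eqP ne1].
  by under eq_bigr => j _ do rewrite expr1n; rewrite sumr_const card_ord mulr1.
have := subrX1 (w ^ a) n; rewrite exprnP exprz_exp mulrC -exprz_exp -exprnP wn.
rewrite exp1rz subrr => /esym/eqP; rewrite mulf_eq0 subr_eq0 (negPf ne1) /=.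
by rewrite mulr0 => /eqP.
Qed.

(** * Averages over the vertices of the cycle *)

Lemma big_dvdn {V : nmodType} (n k : nat) (f : nat -> V) : (0 < n)%N ->
  \sum_(1 <= m < k.+1 | (n %| m)%N) f m
  = \sum_(1 <= s < (k %/ n).+1) f (s * n)%N.
Proof.
move=> n0; elim: k => [|k IHk]; first by rewrite div0n !big_geq.
rewrite big_mkcond big_nat_recr //= -big_mkcond IHk divnS //.
case: ifP => dvd; last by rewrite addr0.
rewrite [in RHS]big_nat_recr //=; congr (_ + f _).
by rewrite -[LHS](divnK dvd) divnS // dvd.
Qed.

Lemma vertex_factor {R : realType} (n j : nat) (c : R) :
  let x := cis (2 * (pi / n%:R)) ^+ j in
  (2 * c * sin (pi * j%:R / n%:R) ^+ 2 + 1 - c)%:C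
  = 1 + - (c%:C / 2) * (x + x^-1) :> R[i].
Proof.
rewrite /= -cisMn.
have -> : 2 * (pi / n%:R) * j%:R = 2 * (pi * j%:R / n%:R) :> R by ring.
rewrite cis_addV.
have -> : 2 = 2%:C :> R[i] by rewrite rmorph_nat.
rewrite -fmorphV -rmorphM -rmorphN -rmorphM -(rmorph1 (real_complex R)) -rmorphD.
by congr (_%:C); field.
Qed.

(** The common form of both identities. For [m >= 1] the exponents [m] and [- m]
of the Laurent expansion share a coefficient and survive the average against
[x ^ z] when [n] divides [z + m], respectively [z - m]; the exponent 0
survives when [n] divides [z]. *)
Lemma cycle_walk_sum {R : realType} (n k : nat) (c : R) (z : int) : (0 < n)%N ->
  n%:R^-1 * \sum_(0 <= j < n) (cis (2 * (pi / n%:R)) ^+ j) ^ z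
      * (2 * c * sin (pi * j%:R / n%:R) ^+ 2 + 1 - c)%:C ^+ k
  = discI 0 c%:C k * (n%:Z %| z)%Z%:R
    + \sum_(1 <= m < k.+1) (-1) ^+ m * discI m c%:C k
        * ((n%:Z %| m%:Z + z)%Z%:R + (n%:Z %| m%:Z - z)%Z%:R) :> R[i].
Proof.
move=> n0; set w := cis _; set d := fun m => (-1) ^+ m * discI m c%:C k.
have prw : n.-primitive_root w := cis_prim_root n n0.
have nz : (n%:R : R[i]) != 0 by rewrite pnatr_eq0 -lt0n.
have nzw j : w ^+ j != 0 by rewrite expf_neq0 ?cis_neq0.
have expand j : (w ^+ j) ^ z
      * (2 * c * sin (pi * j%:R / n%:R) ^+ 2 + 1 - c)%:C ^+ k
    = d 0 * (w ^+ j) ^ z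
      + \sum_(1 <= m < k.+1) d m * ((w ^+ j) ^ (m%:Z + z) + (w ^+ j) ^ (z - m%:Z)).
  rewrite vertex_factor (@expr_walk _ _ _ _ k) ?mulfV ?nzw // -/w mulrDr.
  rewrite -(@discI_walk_coef _ c%:C k.+1) // [X in X + _]mulrC; congr (_ + _).
  rewrite mulr_sumr; apply: eq_bigr => m _.
  rewrite -(@discI_walk_coef _ c%:C k.+1) // mulrCA !expfzDr ?nzw //; congr (_ * _).
  by rewrite mulrDr exprVn exprnN exprnP [X in X + _]mulrC.
under eq_bigr => j _ do rewrite expand.
rewrite big_split -mulr_sumr prim_root_filter // exchange_big /=.
rewrite mulrDr [d 0](_ : _ = discI 0 c%:C k); last by rewrite /d mul1r.
congr (_ + _); first by rewrite mulrCA mulKf.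
rewrite mulr_sumr; apply: eq_bigr => m _; rewrite -mulr_sumr big_split /=.
rewrite !prim_root_filter // -mulrDr mulrCA mulKf //.
by rewrite -[in RHS](rpredN _ (m%:Z - z)) opprB.
Qed.

Lemma cexp_cis {R : realType} (n j l : nat) :
  cexp (- (2 * pi%:C * (0 +i* 1) * j%:R * l%:R / n%:R))
  = (cis (2 * (pi / n%:R)) ^+ j) ^ (- l%:Z) :> R[i].
Proof.
rewrite -exprnN -exprM -cisMn -cisN.
have -> : - (2 * pi%:C * (0 +i* 1) * j%:R * l%:R / n%:R)
    = 0 +i* (- (2 * (pi / n%:R) * (j * l)%:R)) :> R[i].
  rewrite -!(rmorph_nat (real_complex R)) -fmorphV /=; simpc.
  by rewrite natrM; congr (_ +i* _); ring.
by rewrite /cexp expR0 mul1r.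
Qed.

(** * The two identities *)

(* In the first identity the condition "n divides m +/- l" is read with each
   sign separately: an m satisfying it for both signs (which can only happen
   when n = 2l) contributes one term for each sign. Counting such an m once
   would make the identity false, e.g. for n = 4, l = 2, k = 2, c = 1. *)
Theorem corollary5p2 (R : realType) (n l : nat)
    (hn : (3 <= n)%N) (hl1 : (1 <= l)%N) (hl2 : (l <= n - 1)%N)
    (k : nat) (c : R) :
  n%:R^-1 * \sum_(0 <= j < n)
      cexp (- (2 * pi%:C * (0 +i* 1) * j%:R * l%:R / n%:R))
        * (2 * c * sin (pi * j%:R / n%:R) ^+ 2 + 1 - c)%:C ^+ k
    = \sum_(1 <= m < k.+1)
        \sum_(s <- [:: l%:Z; - l%:Z] | (n%:Z %| m%:Z + s)%Z)
          (-1) ^+ m * discI m c%:C k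
  /\
  n%:R^-1 * \sum_(0 <= j < n)
      (2 * c * sin (pi * j%:R / n%:R) ^+ 2 + 1 - c)%:C ^+ k
    = discI 0 c%:C k
      + 2 * \sum_(1 <= s < (k %/ n).+1) (-1) ^+ (s * n) * discI (s * n) c%:C k.
Proof.
have n0 : (0 < n)%N by lia.
split.
  under eq_bigr => j _ do rewrite cexp_cis.
  rewrite cycle_walk_sum //.
  (* The constant term drops out because [0 < l < n]. *)
  have -> : (n%:Z %| - l%:Z)%Z = false.
    by rewrite rpredN dvdzE !absz_nat gtnNdvd //; lia.
  rewrite mulr0 add0r; apply: eq_bigr => m _.
  rewrite !big_cons big_nil opprK mulrDr addrC.
  by do 2!case: ifP => _; rewrite ?(mulr1, mulr0, addr0, add0r).
have := cycle_walk_sum n k c 0 n0.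
under eq_bigr => j _ do rewrite expr0z mul1r.
rewrite dvdz0 mulr1 => ->; congr (_ + _).
rewrite -(big_dvdn n k (fun m => (-1) ^+ m * discI m c%:C k)) //.
rewrite [in RHS]big_mkcond mulr_sumr; apply: eq_bigr => m _.
rewrite addr0 dvdzE !absz_nat.
by case: ifP => _; rewrite ?addr0 ?mulr0 // mulrC.
Qed.
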